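(* Let $u, v \in A^*$. Then $u \equiv_{\mathrm{B}} v$ if and only if $u \equiv_{\mathrm{S}} v$ and $u \equiv_{\mathrm{S}^\#} v$.
   Context: $A = \{a_1 < a_2 < \cdots\}$ is a totally ordered infinite alphabet and $A^*$ is the free monoid on $A$ (finite words, with concatenation). An equivalence relation $\equiv$ on $A^*$ is a congruence if $u \equiv u'$ and $v \equiv v'$ imply $uv \equiv u'v'$. The Baxter congruence $\equiv_{\mathrm{B}}$ is the smallest congruence on $A^*$ (i.e. the reflexive, symmetric and transitive closure of rewriting factors of words) generated by the following relations, for $u, v \in A^*$ and letters $a,b,c,d \in A$: $c\,u\,a\,d\,v\,b \leftrightarrow c\,u\,d\,a\,v\,b$ where $a \leq b < c \leq d$; and $b\,u\,d\,a\,v\,c \leftrightarrow b\,u\,a\,d\,v\,c$ where $a < b \leq c < d$. The sylvester congruence $\equiv_{\mathrm{S}}$ is the smallest congruence on $A^*$ generated by the relations $a\,c\,u\,b \leftrightarrow c\,a\,u\,b$ for $u \in A^*$ and letters $a \leq b < c$. The $\#$-sylvester congruence $\equiv_{\mathrm{S}^\#}$ is the smallest congruence on $A^*$ generated by the relations $b\,u\,a\,c \leftrightarrow b\,u\,c\,a$ for $u \in A^*$ and letters $a < b \leq c$. *)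

(* Defs.v *)
From Stdlib Require Import Relation_Definitions Relation_Operators.
From mathcomp Require Import all_boot all_order.

Set Implicit Arguments.
Unset Strict Implicit.
Unset Printing Implicit Defensive.

Import Order.TTheory.
Local Open Scope order_scope.

Definition congruence (A : Type) (R : relation (seq A)) : Prop :=
  equivalence (seq A) R /\
  (forall u u' v v', R u u' -> R v v' -> R (u ++ v) (u' ++ v')).

Inductive rewrite_factor (A : Type) (G : relation (seq A)) :
    relation (seq A) :=
  RewriteFactor (p s x y : seq A) of G x y :
    rewrite_factor G (p ++ x ++ s) (p ++ y ++ s).

Definition generated_congruence (A : Type) (G : relation (seq A)) :
    relation (seq A) :=
  clos_refl_sym_trans (seq A) (rewrite_factor G).

Lemma generated_congruence_gen (A : Type) (G : relation (seq A)) x y :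
  G x y -> generated_congruence G x y.
Proof.
move=> Gxy; apply: rst_step.
by have := RewriteFactor [::] [::] Gxy; rewrite /= !cats0.
Qed.

Lemma generated_congruenceP (A : Type) (G : relation (seq A)) :
  congruence (generated_congruence G).
Proof.
have ctx p s x y : generated_congruence G x y ->
    generated_congruence G (p ++ x ++ s) (p ++ y ++ s).
  elim=> {x y} [_ _ [q t x y Gxy] | x | x y _ | x y z _ xy _ yz].
  - apply: rst_step; rewrite -!catA !(catA p).
    exact: RewriteFactor.
  - exact: rst_refl.
  - exact: rst_sym.
  - exact: rst_trans xy yz.
split=> [|u u' v v' uu' vv'].
  by split=> [x | x y z | x y]; [exact: rst_refl | exact: rst_trans
                                | exact: rst_sym].
apply: (@rst_trans _ _ _ (u' ++ v)); first exact: (ctx [::] v).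
by have := ctx u' [::] _ _ vv'; rewrite !cats0.
Qed.

Lemma generated_congruence_min (A : Type) (G R : relation (seq A)) :
  congruence R -> (forall x y, G x y -> R x y) ->
  forall x y, generated_congruence G x y -> R x y.
Proof.
case=> -[Rrefl Rtrans Rsym] Rcat GR x y.
elim=> {x y} [_ _ [p s x y /GR Rxy] | x | x y _ | x y z _ xy _ yz].
- by apply: (Rcat) (Rrefl p) _; apply: Rcat Rxy (Rrefl s).
- exact: Rrefl.
- exact: Rsym.
- exact: Rtrans xy yz.
Qed.

Section Relations.
Context (d : Order.disp_t) (A : orderType d).

Inductive baxter_rel : relation (seq A) :=
| Baxter1 (u v : seq A) (a b c d : A) of a <= b & b < c & c <= d :
    baxter_rel ([:: c] ++ u ++ [:: a; d] ++ v ++ [:: b])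
               ([:: c] ++ u ++ [:: d; a] ++ v ++ [:: b])
| Baxter2 (u v : seq A) (a b c d : A) of a < b & b <= c & c < d :
    baxter_rel ([:: b] ++ u ++ [:: d; a] ++ v ++ [:: c])
               ([:: b] ++ u ++ [:: a; d] ++ v ++ [:: c]).

Inductive sylvester_rel : relation (seq A) :=
  Sylvester (u : seq A) (a b c : A) of a <= b & b < c :
    sylvester_rel ([:: a; c] ++ u ++ [:: b]) ([:: c; a] ++ u ++ [:: b]).

Inductive sharp_sylvester_rel : relation (seq A) :=
  SharpSylvester (u : seq A) (a b c : A) of a < b & b <= c :
    sharp_sylvester_rel ([:: b] ++ u ++ [:: a; c]) ([:: b] ++ u ++ [:: c; a]).

Definition baxter : relation (seq A) := generated_congruence baxter_rel.

Definition sylvester : relation (seq A) := generated_congruence sylvester_rel.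

Definition sharp_sylvester : relation (seq A) :=
  generated_congruence sharp_sylvester_rel.

End Relations.

(* Main.v *)
Require Import Defs.
From Stdlib Require Import Relation_Definitions Relation_Operators.
From mathcomp Require Import all_boot all_order zify.

(** Call a letter [b] a witness for two letters [x] and [y] when it lies between
    them.  The sylvester relations exchange two adjacent letters when a later
    letter [b] satisfies [min <= b < max]; the sharp ones exchange them when an
    earlier letter [e] satisfies [min < e <= max].  According to whether [b < e]
    or [e <= b], the two Baxter relations say precisely that adjacent letters may
    be exchanged when both witnesses are present ([baxter_swap]).  So a Baxter
    step is both a sylvester step and a sharp sylvester step, which settles one
    direction.

    For the converse, let [u] and [v] be equivalent for both congruences.  If [u]
    has adjacent letters [y x] and the corresponding occurrences of [x] and [y]
    appear in the opposite order in [v], then the later witness must exist: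
    without it, the restriction of [u] to the letters from [min] to [max] ends in
    [min] followed by copies of [max]; such an ending is preserved by sylvester
    equivalence ([sylvester_suffix_invariant]) and determines the order of the two
    occurrences.  This is [sylvester_crossing].  Reversing both the words and
    the order of the alphabet exchanges the two sylvester congruences, and turns
    this statement into its analogue for earlier witnesses.  Hence the exchange of
    [y] and [x] in [u] is a Baxter step.

    Such exchanges transform [u] into [v] letter by letter: once [u] and [v] agree
    on a prefix, the first occurrence in the rest of [u] of the next letter of [v]
    moves left by exchanges of this kind until it joins the prefix. *)

Set Implicit Arguments.
Unset Strict Implicit.
Unset Printing Implicit Defensive.

Import Order.TTheory.
Local Open Scope order_scope.

(** * Congruences given by generators *)

Lemma generated_congruence_refl (A : Type) (G : relation (seq A)) u :
  generated_congruence G u u.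
Proof. exact: rst_refl. Qed.

Lemma generated_congruence_sym (A : Type) (G : relation (seq A)) u v :
  generated_congruence G u v -> generated_congruence G v u.
Proof. exact: rst_sym. Qed.

Lemma generated_congruence_trans (A : Type) (G : relation (seq A)) v u w :
  generated_congruence G u v -> generated_congruence G v w ->
  generated_congruence G u w.
Proof. exact: rst_trans. Qed.

Lemma generated_congruence_ctx (A : Type) (G : relation (seq A)) p s u v :
  G u v -> generated_congruence G (p ++ u ++ s) (p ++ v ++ s).
Proof. by move=> Guv; apply: rst_step; apply: RewriteFactor. Qed.

Lemma generated_congruence_invariant (A T : Type) (G : relation (seq A))
    (f : seq A -> T) :
  (forall p s x y, G x y -> f (p ++ x ++ s) = f (p ++ y ++ s)) ->
  forall u v, generated_congruence G u v -> f u = f v.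
Proof.
move=> fG u v; elim=> {u v} [_ _ [p s x y Gxy] | // | // | x y z _ -> //].
exact: fG.
Qed.

(** * Suffixes and occurrences in words *)

Section Words.
Context (T : eqType).
Implicit Types (a b c x y : T) (p q t w : seq T).

Lemma suffix_catr_neq w t a c b m :
  b \in t -> b != c ->
  suffix (a :: nseq m c) (w ++ t) = suffix (a :: nseq m c) t.
Proof.
move=> bt bNc; elim: w => //= x w <-.
apply/idP/idP=> [/suffixP[[|x' r]] [_ wt_eq]|]; last exact: (suffix_catr [:: x]).
  have: b \in w ++ t by rewrite mem_cat bt orbT.
  by rewrite wt_eq mem_nseq (negPf bNc) andbF.
by rewrite wt_eq suffix_suffix.
Qed.

(** A suffix of [w ++ a :: nseq m c] lies inside the final block of letters [c]
    or contains this whole block, and the presence of [a] tells which. *)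
Lemma suffix_nseq_count a c m p q :
  a != c -> suffix (a :: nseq m c) (p ++ q) ->
  (if a \in q then (m <= count_mem c q)%N else (count_mem c q <= m)%N).
Proof.
move=> aNc /suffixP[w pq_eq].
have -> : q = drop (size p) (w ++ a :: nseq m c) by rewrite -pq_eq drop_size_cat.
rewrite -cat_rcons drop_cat size_rcons; case: ltnP => [lt_pw|_].
  rewrite drop_rcons 1?cat_rcons; last by lia.
  rewrite mem_cat mem_head orbT count_cat /= count_nseq /= eqxx; lia.
have -> : (a \in drop (size p - (size w).+1) (nseq m c)) = false.
  by apply/negP => /mem_drop; rewrite mem_nseq (negPf aNc) andbF.
by rewrite (leq_trans (count_size _ _)) // size_drop size_nseq leq_subr.
Qed.

(** With equal letters numbered from left to right, the hypotheses say that the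
    displayed occurrences of [y] and [x] are separated by the cut of the second
    word, with [x] on the left; the conclusion says it in the numbering from right
    to left. *)
Lemma count_crossing x y p q p' q' :
  (forall z, count_mem z (p ++ [:: y; x] ++ q) = count_mem z (p' ++ q')) ->
  (count_mem x p < count_mem x p')%N -> (count_mem y p' <= count_mem y p)%N ->
  (count_mem y q < count_mem y q')%N /\ (count_mem x q' <= count_mem x q)%N.
Proof.
move=> count_eq ltx ley.
have xNy : x != y by apply: contraTneq ltx => ->; rewrite -leqNgt.
have yNx : y != x by rewrite eq_sym.
have := count_eq x; have := count_eq y.
rewrite !count_cat /= !eqxx (negPf xNy) (negPf yNx).
move: (count_mem x p) (count_mem x p') (count_mem x q) (count_mem x q') ltx.
move: (count_mem y p) (count_mem y p') (count_mem y q) (count_mem y q') ley.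
lia.
Qed.

End Words.

(** * Exchanging adjacent letters *)

Section Witnesses.
Context (d : Order.disp_t) (A : orderType d).
Implicit Types (x y : A) (p q u v w : seq A).

Definition witness_after x y q : bool :=
  has (fun b => (x <= b < y) || (y <= b < x)) q.

Definition witness_before x y p : bool :=
  has (fun e => (x < e <= y) || (y < e <= x)) p.

Lemma witness_afterC x y q : witness_after x y q = witness_after y x q.
Proof. by apply: eq_has => b; rewrite orbC. Qed.

Lemma witness_beforeC x y p : witness_before x y p = witness_before y x p.
Proof. by apply: eq_has => e; rewrite orbC. Qed.

(** An earlier witness [e] and a later witness [b] fall under the first Baxter
    relation if [b < e], and under the second one if [e <= b]. *)
Lemma baxter_swap x y p q :
  witness_before x y p -> witness_after x y q ->
  baxter (p ++ [:: y; x] ++ q) (p ++ [:: x; y] ++ q).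
Proof.
wlog lt_xy: x y / x < y => [swap_lt wp wq|].
  case: (ltgtP x y) => [lt_xy|lt_yx|->]; last exact: generated_congruence_refl.
    exact: swap_lt.
  by apply/generated_congruence_sym/swap_lt; rewrite // 1?witness_beforeC
    1?witness_afterC.
have Nlow z : (y <= z < x) = false.
  apply/negP => /andP[yz zx].
  by move: (le_lt_trans yz zx); rewrite (lt_gtF lt_xy).
have Nhigh z : (y < z <= x) = false.
  apply/negP => /andP[yz zx].
  by move: (lt_le_trans yz zx); rewrite (lt_gtF lt_xy).
case/hasP=> e /splitPr[p1 p2]; rewrite Nhigh orbF => /andP[xe ey].
case/hasP=> b /splitPr[q1 q2]; rewrite Nlow orbF => /andP[xb b_y].
have split_word s : (p1 ++ e :: p2) ++ s ++ q1 ++ b :: q2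
    = p1 ++ ([:: e] ++ p2 ++ s ++ q1 ++ [:: b]) ++ q2.
  by rewrite -!catA.
rewrite !split_word; case: (ltP b e) => [be|eb].
  exact/generated_congruence_sym/generated_congruence_ctx/Baxter1.
exact/generated_congruence_ctx/Baxter2.
Qed.

Lemma baxter_sylvester u v : baxter u v -> sylvester u v.
Proof.
apply: generated_congruence_min; first exact: generated_congruenceP.
have step w w' a b c x s : a <= b -> b < c ->
    sylvester (x :: w ++ [:: a; c] ++ w' ++ b :: s)
              (x :: w ++ [:: c; a] ++ w' ++ b :: s).
  move=> ab bc.
  have := generated_congruence_ctx (x :: w) s (Sylvester w' ab bc).
  by rewrite /= -!catA.
move=> _ _ [w w' a b c e ab bc ce | w w' a b c e ab bc ce].
  by apply: step => //; apply: lt_le_trans ce.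
by apply/generated_congruence_sym/step => //; apply: le_trans bc; apply: ltW.
Qed.

Lemma baxter_sharp_sylvester u v : baxter u v -> sharp_sylvester u v.
Proof.
apply: generated_congruence_min; first exact: generated_congruenceP.
have step w s a b c : a < b -> b <= c ->
    sharp_sylvester (b :: w ++ [:: a; c] ++ s) (b :: w ++ [:: c; a] ++ s).
  move=> ab bc.
  have := generated_congruence_ctx [::] s (SharpSylvester w ab bc).
  by rewrite /= -!catA.
move=> _ _ [w w' a b c e ab bc ce | w w' a b c e ab bc ce].
  by apply: step => //; apply: le_lt_trans bc.
by apply/generated_congruence_sym/step => //; apply: le_trans (ltW ce).
Qed.

(** * The later witness *)

Lemma sylvester_count u v x : sylvester u v -> count_mem x u = count_mem x v.
Proof.
apply: generated_congruence_invariant => p s _ _ [w a b c _ _].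
by rewrite !count_cat /=; lia.
Qed.

(** A sylvester step that exchanges two letters of [[a, c]] has a later letter in
    [[a, c)], and the suffix [a :: nseq m c] of the restricted word cannot reach
    beyond the last such letter; every other step leaves the restriction to
    [[a, c]] unchanged. *)
Lemma sylvester_suffix_invariant a c m u v :
  sylvester u v ->
  suffix (a :: nseq m c) [seq z <- u | a <= z <= c]
    = suffix (a :: nseq m c) [seq z <- v | a <= z <= c].
Proof.
pose ends w := suffix (a :: nseq m c) [seq z <- w | a <= z <= c].
apply: (generated_congruence_invariant (f := ends)).
move=> p s _ _ [w a' b c' ab bc]; rewrite /ends !filter_cat /=.
have [/andP[aa' a'c]|_] := boolP (a <= a' <= c); last by case: ifP.
have [/andP[ac' c'c]|_] := boolP (a <= c' <= c); last by [].
have b_in : a <= b <= c.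
  by rewrite (le_trans aa' ab) (ltW (lt_le_trans bc c'c)).
have bNc : b != c by rewrite lt_eqF // (lt_le_trans bc c'c).
have drop2 r x y t : b \in t ->
    suffix (a :: nseq m c) (r ++ x :: y :: t) = suffix (a :: nseq m c) t.
  by move=> bt; rewrite -(suffix_catr_neq (r ++ [:: x; y]) _ _ bt bNc) -catA.
by rewrite b_in !drop2 // !mem_cat mem_head orbT.
Qed.

Lemma filter_itv_nseq a c q :
  a <= c -> ~~ has (fun b => a <= b < c) q ->
  [seq z <- q | a <= z <= c] = nseq (count_mem c q) c.
Proof.
move=> ac; elim: q => //= z q IHq; rewrite negb_or => /andP[zN /IHq ->].
have [->|zNc] := eqVneq z c; first by rewrite ac lexx.
by move: zN; rewrite lt_neqAle zNc /= => /negPf ->.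
Qed.

(** The word [p ++ a :: q], restricted to [[a, c]], ends in [a] followed by all
    the letters [c] of [q], hence so does the restriction of [p' ++ q']; the
    conclusion compares the cut before [q'] with this ending. *)
Lemma sylvester_last_count a c p q p' q' :
  a < c -> ~~ has (fun b => a <= b < c) q ->
  sylvester (p ++ a :: q) (p' ++ q') ->
  (if a \in q' then (count_mem c q <= count_mem c q')%N
   else (count_mem c q' <= count_mem c q)%N).
Proof.
move=> ac noq /(sylvester_suffix_invariant a c (count_mem c q)).
rewrite !filter_cat /= lexx (ltW ac) (filter_itv_nseq (ltW ac) noq).
rewrite suffix_suffix => /esym/(suffix_nseq_count (negbT (lt_eqF ac))).
have -> : count_mem c [seq z <- q' | a <= z <= c] = count_mem c q'.
  rewrite count_filter; apply: eq_count => z /=.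
  by case: eqP => // ->; rewrite lexx (ltW ac).
by rewrite mem_filter lexx (ltW ac).
Qed.

(** Without a later witness, [sylvester_last_count] applies to the smaller of [x]
    and [y], which is followed in the first word by the larger one when it is
    [y], and preceded by it when it is [x]. *)
Lemma sylvester_crossing x y p q p' q' :
  sylvester (p ++ [:: y; x] ++ q) (p' ++ q') ->
  (count_mem x p < count_mem x p')%N -> (count_mem y p' <= count_mem y p)%N ->
  witness_after x y q.
Proof.
move=> syl_uv ltx ley; apply/contraT; rewrite /witness_after has_predU negb_or.
case/andP=> noxy noyx.
have [lty lex] := count_crossing (fun z => sylvester_count z syl_uv) ltx ley.
case: (ltgtP x y) => [lt_xy|lt_yx|eq_xy]; last first.
- by move: ltx; rewrite eq_xy ltnNge ley.
- have noxq : ~~ has (fun b => y <= b < x) (x :: q) by rewrite /= ltxx andbF.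
  have := sylvester_last_count lt_yx noxq syl_uv.
  have -> : y \in q' by rewrite -has_pred1 has_count (leq_ltn_trans _ lty).
  by rewrite /= eqxx add1n ltnNge lex.
- rewrite -[[:: y; x] ++ q]/([:: y] ++ x :: q) catA in syl_uv.
  have := sylvester_last_count lt_xy noxy syl_uv.
  have /negPf-> : x \notin q'.
    rewrite -has_pred1 has_count -leqNgt (leq_trans lex) //.
    rewrite leqNgt -has_count has_pred1; apply: contra noxy => xq.
    by apply/hasP; exists x; rewrite // lexx.
  by rewrite leqNgt lty.
Qed.

End Witnesses.

(** * The earlier witness *)

Section Crossings.
Context (d : Order.disp_t) (A : orderType d).
Implicit Types (x y : A) (p q u v w : seq A).

(** Reversed words over the dual order turn the condition [a < b <= c] on a
    letter to the left into the condition [a <= b < c] on a letter to the right. *)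
Lemma sharp_sylvester_rev u v :
  sharp_sylvester u v -> @sylvester _ A^d (rev u) (rev v).
Proof.
pose R u v := @sylvester _ A^d (rev u) (rev v).
apply: (@generated_congruence_min _ _ R).
  have [[Srefl Strans Ssym] Scat] := generated_congruenceP (@sylvester_rel _ A^d).
  split=> [|w w' s s' ww' ss']; last by rewrite /R !rev_cat; apply: Scat.
  split=> [w|w1 w2 w3|w1 w2]; [exact: Srefl | exact: Strans | exact: Ssym].
move=> _ _ [w a b c ab bc]; rewrite /R !rev_cat -!catA.
apply: generated_congruence_gen.
exact: (@Sylvester _ A^d (rev w) c b a).
Qed.

(** Reversal exchanges left and right, hence also the roles of [x] and [y] in
    [sylvester_crossing]. *)
Lemma sharp_sylvester_crossing x y p q p' q' :
  sharp_sylvester (p ++ [:: y; x] ++ q) (p' ++ q') ->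
  (count_mem x p < count_mem x p')%N -> (count_mem y p' <= count_mem y p)%N ->
  witness_before x y p.
Proof.
move=> /sharp_sylvester_rev syl_uv ltx ley.
have count_uv z : count_mem z (p ++ [:: y; x] ++ q) = count_mem z (p' ++ q').
  by have := sylvester_count (z : A^d) syl_uv; rewrite !count_rev.
have [lty lex] := count_crossing count_uv ltx ley.
rewrite !rev_cat -catA in syl_uv.
have := sylvester_crossing syl_uv; rewrite !count_rev => /(_ lty lex).
rewrite /witness_after has_rev; apply: sub_has => e.
by rewrite !leEdual !ltEdual [X in X || _]andbC [X in _ || X]andbC.
Qed.

(** * From both sylvester congruences to the Baxter congruence *)

(** The letter [x] stands to the left of all of [s1] in the target [p ++ x :: t],
    so that each letter of [s1] crosses it and both witnesses exist; after each
    exchange the word is still equivalent to the target. *)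
Lemma baxter_move_left x p s1 s2 t :
  x \notin s1 ->
  sylvester (p ++ s1 ++ x :: s2) (p ++ x :: t) ->
  sharp_sylvester (p ++ s1 ++ x :: s2) (p ++ x :: t) ->
  baxter (p ++ s1 ++ x :: s2) (p ++ x :: s1 ++ s2).
Proof.
elim/last_ind: s1 s2 => [|s1 y IHs1] s2; first by move=> *; apply: rst_refl.
rewrite mem_rcons inE negb_or => /andP[xNy xNs1].
have -> : p ++ rcons s1 y ++ x :: s2 = (p ++ s1) ++ [:: y; x] ++ s2.
  by rewrite cat_rcons -catA.
move=> syl sharp.
have ltx : (count_mem x (p ++ s1) < count_mem x (rcons p x))%N.
  by rewrite -cats1 !count_cat /= eqxx (count_memPn xNs1) addn0 addn1.
have ley : (count_mem y (rcons p x) <= count_mem y (p ++ s1))%N.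
  by rewrite -cats1 !count_cat /= (negPf xNy) !addn0 leq_addr.
have before : witness_before x y (p ++ s1).
  by apply: (sharp_sylvester_crossing _ ltx ley); rewrite cat_rcons; exact: sharp.
have after : witness_after x y s2.
  by apply: (sylvester_crossing _ ltx ley); rewrite cat_rcons; exact: syl.
have swap := baxter_swap before after.
have swapE : (p ++ s1) ++ [:: x; y] ++ s2 = p ++ s1 ++ x :: y :: s2.
  by rewrite -catA.
rewrite swapE in swap; apply: generated_congruence_trans (swap) _.
have swap' := generated_congruence_sym swap.
rewrite (cat_rcons y); apply: IHs1 => //.
- exact: generated_congruence_trans (baxter_sylvester swap') syl.
- exact: generated_congruence_trans (baxter_sharp_sylvester swap') sharp.
Qed.

(** The common prefix [p] is kept in the statement, since the sharp
    sylvester and the Baxter congruences are not left cancellative in general: the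
    letters of [p] may be the earlier witnesses of exchanges in [s]. *)
Lemma baxter_of_sylvester p s t :
  sylvester (p ++ s) (p ++ t) -> sharp_sylvester (p ++ s) (p ++ t) ->
  baxter (p ++ s) (p ++ t).
Proof.
elim: t p s => [|x t IHt] p s syl sharp.
  case: s syl sharp => [|y s] syl _; first exact: generated_congruence_refl.
  by have := sylvester_count y syl; rewrite !count_cat /= eqxx; lia.
have : has (pred1 x) s.
  rewrite has_count; have := sylvester_count x syl.
  by rewrite !count_cat /= eqxx; lia.
move=> has_x; case: (split_find has_x) syl sharp => y s1 s2 /eqP->{has_x y}.
rewrite has_pred1 cat_rcons => xNs1 syl sharp.
have move_x := baxter_move_left xNs1 syl sharp.
apply: generated_congruence_trans (move_x) _; rewrite -!(cat_rcons x p).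
have move_x' := generated_congruence_sym move_x.
apply: IHt; rewrite !(cat_rcons x p).
- exact: generated_congruence_trans (baxter_sylvester move_x') syl.
- exact: generated_congruence_trans (baxter_sharp_sylvester move_x') sharp.
Qed.

End Crossings.

Theorem proposition3p5 (d : Order.disp_t) (A : orderType d)
  (letter : nat -> A)
  (letter_lt : forall i j : nat, (i < j)%N -> (letter i < letter j)%O)
  (letter_surj : forall x : A, exists i : nat, letter i = x)
  (u v : seq A) :
  baxter u v <-> sylvester u v /\ sharp_sylvester u v.
Proof.
split=> [bax_uv|[syl_uv sharp_uv]]; last exact: (@baxter_of_sylvester _ _ [::]).
by split; [exact: baxter_sylvester | exact: baxter_sharp_sylvester].
Qed.
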